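(* For all integers $n,\ell$, \[ \sum_{j=0}^{n}\frac{(-1;q)_j(-1)^jq^{-j(n+\ell)}}{(q;q)_j}=(-1)^{\ell}\frac{(q^{n+1};q)_{\ell}}{(-q^{n+1};q)_{\ell}}\sum_{j=0}^{n+\ell}\frac{(-1;q)_j(-1)^jq^{-jn}}{(q;q)_j}. \]
   Context: Here $0<|q|<1$. Notation: $(a;q)_0=1$, $(a;q)_k=\prod_{i=0}^{k-1}(1-aq^i)$ for $k\ge1$, and for $k\ge1$, $(a;q)_{-k}=\prod_{i=1}^{k}(1-a/q^{i})^{-1}$. A sum $\sum_{j=0}^{N}$ with $N<0$ is empty (equal to $0$).
   Formalization: The identity is stated for all integers n, ℓ except those with n ≥ 0 and n+ℓ < 0, where (q^{n+1};q)_ℓ contains the factor 1/(1−q^0) and the right-hand side is undefined. *)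

(* Defs.v *)
From mathcomp Require Import all_boot all_order all_algebra.
From mathcomp Require Import complex reals.
From mathcomp Require Import zify.

Set Implicit Arguments.
Unset Strict Implicit.
Unset Printing Implicit Defensive.

Import Order.TTheory GRing.Theory Num.Theory.
Local Open Scope ring_scope.

(* q-shifted factorial (a; q)_k for k : int.  [Negz m] is the integer -(m+1),
   so the second product runs over 1 <= i <= -k. *)
Definition qpoch (F : fieldType) (q a : F) (k : int) : F :=
  match k with
  | Posz m => \prod_(0 <= i < m) (1 - a * q ^+ i)
  | Negz m => \prod_(1 <= i < m.+2) (1 - a / q ^+ i)^-1
  end.

(* (a; q)_k is meaningful: no factor 1 - a / q ^ i that gets inverted is 0.
   It is needed because inversion is total here (0^-1 = 0). *)
Definition qpoch_defined (F : fieldType) (q a : F) (k : int) : Prop :=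
  match k with
  | Posz _ => True
  | Negz m => forall i : nat, (1 <= i < m.+2)%N -> 1 - a / q ^+ i != 0
  end.

(* \sum_(j = 0)^N f j with an integer upper bound; empty when N < 0. *)
Definition sum0 (V : zmodType) (N : int) (f : nat -> V) : V :=
  match N with
  | Posz m => \sum_(0 <= j < m.+1) f j
  | Negz _ => 0
  end.

Lemma expfz_neq1 (F : numFieldType) (q : F) (m : int) :
  0 < `|q| -> `|q| < 1 -> m != 0 -> `|q ^ m| != 1.
Proof.
move=> q0 q1; case: m => m m0.
  by rewrite -exprnP normrX lt_eqF // exprn_ilt1.
by rewrite NegzE -exprnN normfV normrX invr_eq1 lt_eqF // exprn_ilt1.
Qed.

(* For 0 < |q| < 1, (q^(n+1); q)_l is undefined exactly when n + l < 0 <= n. *)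
Lemma qpoch_definedE (F : numFieldType) (q : F) (n l : int) :
  0 < `|q| -> `|q| < 1 ->
  qpoch_defined q (q ^ (n + 1)) l <-> ~ (0 <= n /\ n + l < 0).
Proof.
move=> q0 q1; have qn0 : q != 0 by rewrite -normr_gt0.
have E (i : nat) : q ^ (n + 1) / q ^+ i = q ^ (n + 1 - i%:Z).
  by rewrite (expfzDr _ (- i%:Z) qn0) -invr_expz.
case: l => m /=; first by split=> // _ [n0]; lia.
split=> [H [n0 nl]|H i /andP[i1 im]].
  have [k nk] : exists k : nat, n = k%:Z by exists `|n|%N; lia.
  have /H : (1 <= k.+1 < m.+2)%N by lia.
  rewrite E (_ : n + 1 - k.+1%:Z = 0); last by lia.
  by rewrite expr0z subrr eqxx.
rewrite E subr_eq0 eq_sym; case: (eqVneq (n + 1 - i%:Z) 0) => [e|ne].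
  by case: H; lia.
by apply: contra_neq (expfz_neq1 q0 q1 ne) => ->; exact: normr1.
Qed.

(* Main.v *)
(* For n, m >= 0 let U n m = (-1)^n (q; q)_n / (-q; q)_n * S n m, where S n m is
   the sum over j <= n of (-1; q)_j (-1)^j q^(-jm) / (q; q)_j. With m = n + l, the
   identity says U n m = U m n. Adding the last term to S gives
     (1 + q^n) U n m + (1 - q^n) U (n-1) m = 2 q^(-nm),
   and an induction on n shows that U satisfies the mirror recurrence in m;
   as the recurrence determines U, it is symmetric. If n < 0 <= n + l, both
   sides vanish, because (q^(n+1); q)_l contains the factor 1 - q^0. *)
Require Import Defs.
From mathcomp Require Import all_boot all_order all_algebra.
From mathcomp Require Import complex reals.
From mathcomp Require Import zify ring.

Import Order.TTheory GRing.Theory Num.Theory.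
Local Open Scope ring_scope.

Section Qpoch.
Local Set Implicit Arguments.
Local Unset Strict Implicit.
Variables (F : fieldType) (q : F).

Lemma qpoch0 (a : F) : qpoch q a 0%N = 1.
Proof. by rewrite /= big_geq. Qed.

Lemma qpochS (a : F) (n : nat) :
  qpoch q a n.+1 = qpoch q a n * (1 - a * q ^+ n).
Proof. by rewrite /= big_nat_recr. Qed.

Lemma qpoch_neq0 (a : F) (n : nat) :
  (forall i, 1 - a * q ^+ i != 0) -> qpoch q a n != 0.
Proof.
move=> a_reg; elim: n => [|n IHn]; first by rewrite qpoch0 oner_neq0.
by rewrite qpochS mulf_neq0.
Qed.

Lemma qpoch_addn (a : F) (n k : nat) :
  qpoch q a n * qpoch q (a * q ^+ n) k = qpoch q a (n + k)%N.
Proof.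
elim: k => [|k IHk]; first by rewrite qpoch0 mulr1 addn0.
by rewrite addnS !qpochS mulrA IHk exprD mulrA.
Qed.

(** Read backwards, the inverted product runs over the factors of [(a; q)] of index [n] to [n + k];
    [qpoch_addn] makes it a quotient. *)
Lemma qpoch_oppn (a : F) (n k : nat) : q != 0 ->
  (forall i, 1 - a * q ^+ i != 0) ->
  qpoch q (a * q ^+ (n + k.+1)) (Negz k) = qpoch q a n / qpoch q a (n + k.+1)%N.
Proof.
move=> q0 a_reg; rewrite [LHS]/= prodfV.
have -> : \prod_(1 <= i < k.+2) (1 - a * q ^+ (n + k.+1) / q ^+ i)
        = qpoch q (a * q ^+ n) k.+1.
  rewrite big_add1 big_nat_rev /=; apply: eq_big_nat => i /andP[_ ik].
  rewrite -!mulrA -[in RHS]exprD -exprB ?unitfE //; last by lia.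
  by congr (1 - a * q ^+ _); lia.
rewrite -[in RHS]qpoch_addn invfM mulrA divff ?mul1r //.
exact: qpoch_neq0.
Qed.

(** Separates [n] from [m] whatever the sign of [m - n], so the prefactor of the identity splits
    into one part for each index. *)
Lemma qpoch_ratio (a : F) (n m : nat) : q != 0 ->
  (forall i, 1 - a * q ^+ i != 0) ->
  qpoch q (a * q ^+ n) (m%:Z - n%:Z) = qpoch q a m / qpoch q a n.
Proof.
move=> q0 a_reg; case: (leqP n m) => [nm|mn].
  rewrite (_ : m%:Z - n%:Z = (m - n)%N); last by lia.
  apply: (mulfI (qpoch_neq0 n a_reg)).
  by rewrite qpoch_addn subnKC // mulrC divfK ?qpoch_neq0.
have -> : n = (m + (n - m.+1).+1)%N by lia.
rewrite (_ : m%:Z - _ = Negz (n - m.+1)); last by lia.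
exact: qpoch_oppn.
Qed.

Lemma qpoch_eq0 (i k : nat) : q != 0 -> (i < k)%N ->
  qpoch q (q ^- i) k = 0.
Proof.
move=> q0 ik; apply/eqP; rewrite /= prodf_seq_eq0; apply/hasP; exists i.
  by rewrite mem_index_iota.
by rewrite mulVf ?subrr ?expf_neq0 ?eqxx.
Qed.

(** Both sides are [(-1; q)_(n+1)]: its last factor is [1 + q^n], its first is 2. *)
Lemma qpoch_N1 (n : nat) :
  qpoch q (-1) n * (1 + q ^+ n) = 2 * qpoch q (- q) n.
Proof.
elim: n => [|n IHn]; first by rewrite !qpoch0 expr0; ring.
by rewrite !qpochS !mulNr !opprK mul1r IHn -exprS mulrA.
Qed.

End Qpoch.

Section Symmetry.
Local Set Implicit Arguments.
Local Unset Strict Implicit.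
Variables (F : fieldType) (q : F).
Hypothesis q0 : q != 0.
Hypothesis addq_neq0 : forall i, 1 + q ^+ i != 0.
Hypothesis subq_neq0 : forall i, 1 - q ^+ i.+1 != 0.

Definition trunc_sum (n m : nat) : F :=
  \sum_(0 <= j < n.+1)
    qpoch q (-1) j * (-1) ^+ j * q ^- (j * m) / qpoch q q j.

Definition scaled_sum (n m : nat) : F :=
  (-1) ^+ n * (qpoch q q n / qpoch q (- q) n) * trunc_sum n m.

Lemma subq_reg (i : nat) : 1 - q * q ^+ i != 0.
Proof. by rewrite -exprS. Qed.

Lemma addq_reg (i : nat) : 1 - - q * q ^+ i != 0.
Proof. by rewrite mulNr opprK -exprS. Qed.

Lemma scaled_sum0 (m : nat) : scaled_sum 0 m = 1.
Proof.
rewrite /scaled_sum /trunc_sum big_nat1 !qpoch0 mul0n !expr0.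
by rewrite invr1 !mulr1.
Qed.

(** From [n] to [n + 1] the prefactor gains [-(1 - q^(n+1)) / (1 + q^(n+1))], so the old sums
    cancel; by [qpoch_N1] the new term contributes [2 q^(-(n+1)m) / (1 + q^(n+1))]. *)
Lemma scaled_sumS (n m : nat) :
  (1 + q ^+ n.+1) * scaled_sum n.+1 m + (1 - q ^+ n.+1) * scaled_sum n m
  = 2 * q ^- (n.+1 * m).
Proof.
have Pn0 := qpoch_neq0 n subq_reg; have Nn0 := qpoch_neq0 n addq_reg.
have tN : qpoch q (-1) n.+1 = 2 * qpoch q (- q) n.
  by rewrite qpochS mulNr mul1r opprK qpoch_N1.
rewrite /scaled_sum /trunc_sum [in X in X + _]big_nat_recr //= -/(trunc_sum n m).
rewrite -!/(qpoch q _ (Posz _)) tN !qpochS mulNr opprK -exprS.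
have sq : (-1) ^+ n * (-1) ^+ n = 1 :> F by rewrite -exprMn mulrNN mulr1 expr1n.
rewrite [(-1) ^+ n.+1]exprS.
move: (subq_neq0 n) (addq_neq0 n.+1) sq Pn0 Nn0.
move: (qpoch q q n) (qpoch q (- q) n) (trunc_sum n m) (q ^+ n.+1) => a b t x.
move: (q ^- _) ((-1) ^+ n) => z s x1 x2 sq a0 b0.
(* With [s * s] kept explicit, the equation holds for a free [s], as [field] requires. *)
transitivity (2 * z * (s * s)); last by rewrite sq mulr1.
by field; rewrite a0 b0 x1 x2.
Qed.

Lemma scaled_sumS_r (n m : nat) :
  (1 + q ^+ m.+1) * scaled_sum n m.+1 + (1 - q ^+ m.+1) * scaled_sum n m
  = 2 * q ^- (n * m.+1).
Proof.
elim: n => [|n IHn]; first by rewrite !scaled_sum0 mul0n expr0 invr1; ring.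
have E1 := scaled_sumS n m.+1; have E2 := scaled_sumS n m.
have zE : q ^- (n.+1 * m) = q ^- (n.+1 * m.+1) * q ^+ n.+1.
  by rewrite mulnS exprD invfM mulrAC mulVf ?mul1r // expf_neq0.
have wE : q ^- (n * m.+1) = q ^- (n.+1 * m.+1) * q ^+ m.+1.
  by rewrite mulSn exprD invfM mulrAC mulVf ?mul1r // expf_neq0.
rewrite zE in E2; rewrite wE in IHn.
apply: (mulfI (addq_neq0 n.+1)).
move: IHn E1 E2; move: (scaled_sum n m) (scaled_sum n m.+1) => a b.
move: (scaled_sum n.+1 m) (scaled_sum n.+1 m.+1) => c d.
move: (q ^+ n.+1) (q ^+ m.+1) (q ^- _) => x y z IHn E1 E2.
(* The [n]-recurrences at [m + 1] and [m], combined so that subtracting the induction hypothesis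
   removes [a] and [b]. The right sides [2z], [2zx], [2zy] then add up to [2z(1 + x)]. *)
transitivity ((1 + y) * ((1 + x) * d + (1 - x) * b)
   + (1 - y) * ((1 + x) * c + (1 - x) * a)
   - (1 - x) * ((1 + y) * b + (1 - y) * a)); first by ring.
by rewrite E1 E2 IHn; ring.
Qed.

(** At [m = 0] the right side of the recurrence is 2, and the constant 1 solves it. *)
Lemma scaled_sum_r0 (n : nat) : scaled_sum n 0 = 1.
Proof.
elim: n => [|n IHn]; first exact: scaled_sum0.
apply: (mulfI (addq_neq0 n.+1)); have := scaled_sumS n 0.
by rewrite IHn muln0 expr0 invr1 => /(canRL (addrK _)) ->; ring.
Qed.

Lemma scaled_sumC (n m : nat) : scaled_sum n m = scaled_sum m n.
Proof.
elim: m => [|m IHm]; first by rewrite scaled_sum_r0 scaled_sum0.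
apply: (mulfI (addq_neq0 m.+1)).
(* Each side becomes the left side of one recurrence, in [m] or in the first index. *)
apply: (addIr ((1 - q ^+ m.+1) * scaled_sum n m)).
by rewrite scaled_sumS_r [in RHS]IHm scaled_sumS mulnC.
Qed.

Lemma trunc_sumC (n m : nat) :
  trunc_sum n m = (-1) ^ (m%:Z - n%:Z)
    * (qpoch q (q * q ^+ n) (m%:Z - n%:Z)
       / qpoch q (- q * q ^+ n) (m%:Z - n%:Z)) * trunc_sum m n.
Proof.
rewrite (qpoch_ratio _ _ q0 subq_reg) (qpoch_ratio _ _ q0 addq_reg).
have N10 : -1 != 0 :> F by rewrite oppr_eq0 oner_eq0.
have -> : (-1) ^ (m%:Z - n%:Z) = (-1) ^+ m / (-1) ^+ n :> F.
  by rewrite expfzDr // -invr_expz.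
have := scaled_sumC n m; rewrite /scaled_sum.
have := qpoch_neq0 n subq_reg; have := qpoch_neq0 n addq_reg.
have := qpoch_neq0 m subq_reg; have := qpoch_neq0 m addq_reg.
have : (-1) ^+ n != 0 :> F by rewrite expf_neq0.
move: (qpoch q q n) (qpoch q q m) (qpoch q (- q) n) (qpoch q (- q) m).
move: ((-1) ^+ n) ((-1) ^+ m) (trunc_sum n m) (trunc_sum m n).
move=> s s' t t' a a' b b' s0 b'0 a'0 b0 a0 E.
have c0 : s * (a / b) != 0 by rewrite !mulf_neq0 ?invr_neq0.
by apply: (mulfI c0); rewrite E; field; rewrite s0 b'0 b0 a0.
Qed.

End Symmetry.

Theorem theorem1p6 (R : realType) (q : R[i]) (q_gt0 : 0 < `|q|)
    (q_lt1 : `|q| < 1) (n l : int)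
    (ndef : qpoch_defined q (q ^ (n + 1)) l) :
  sum0 n (fun j : nat =>
    qpoch q (-1) j%:Z * (-1) ^+ j * q ^ (- (j%:Z * (n + l))) / qpoch q q j%:Z)
  = (-1) ^ l * (qpoch q (q ^ (n + 1)) l / qpoch q (- q ^ (n + 1)) l)
    * sum0 (n + l) (fun j : nat =>
        qpoch q (-1) j%:Z * (-1) ^+ j * q ^ (- (j%:Z * n)) / qpoch q q j%:Z).
Proof.
have q0 : q != 0 by rewrite -normr_gt0.
have norm_neq1 i : `|q ^+ i.+1| != 1.
  by have := @expfz_neq1 _ q i.+1 q_gt0 q_lt1 isT.
have addq i : 1 + q ^+ i != 0.
  case: i => [|i]; first by rewrite expr0 -(natrD _ 1 1) pnatr_eq0.
  apply: contra_neq (norm_neq1 i) => /eqP.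
  by rewrite addrC addr_eq0 => /eqP ->; rewrite normrN1.
have subq i : 1 - q ^+ i.+1 != 0.
  apply: contra_neq (norm_neq1 i) => /eqP.
  by rewrite subr_eq0 => /eqP <-; rewrite normr1.
move/(qpoch_definedE _ _ q_gt0 q_lt1): ndef.
move mE : (n + l) => m.
have -> : l = m - n by lia.
case: n mE => n mE; case: m mE => m mE ndef.
- have sumE a b : sum0 a%:Z (fun j : nat => qpoch q (-1) j%:Z * (-1) ^+ j
      * q ^ (- (j%:Z * b%:Z)) / qpoch q q j%:Z) = trunc_sum q a b.
    by apply: eq_bigr => j _; rewrite -PoszM -invr_expz.
  rewrite !sumE (_ : q ^ (n%:Z + 1) = q * q ^+ n).
    by rewrite -mulNr; exact: trunc_sumC.
  by rewrite -PoszD addn1 -exprS.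
(* Here [n >= 0 > m], which definedness excludes. *)
- by case: ndef; lia.
(* The bound is now [-(n + 1)]: the base is [q^(-n)] and the length [m + n + 1] exceeds [n], so the
   zero factor of index [n] occurs. *)
- have -> : m%:Z - Negz n = (m + n.+1)%N by lia.
  rewrite (_ : q ^ (Negz n + 1) = q ^- n).
    by rewrite qpoch_eq0 ?mul0r ?mulr0 ?mul0r //; lia.
  by rewrite (_ : Negz n + 1 = - n%:Z) -?invr_expz //; lia.
- by rewrite /= mulr0.
Qed.
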